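(* Let $X$ be a Hausdorff topological vector space, let $f:X\to\,]-\infty,\infty]$, let $D\subset \mathrm{dom} f$ and $u_0\in D$. Assume that $D$ is strongly star-shaped relative to $u_0$, that $f$ is ru-usc in $D$ relative to $u_0$, and that $\inf_D f>-\infty$. Denote by $\overline{D}^{s}$ the sequential closure of $D$ and by $\overline{g}^{s}$ the sequential relaxation of a function $g$. Then: (i) if $\overline{f+\chi_D}^{s}=f$ on $D$, then $\overline{f+\chi_D}^{s}=\widehat{f}_{u_0}+\chi_{\overline{D}^{s}}$ on $X$; (ii) $\widehat{f}_{u_0}(u)=\lim_{t\uparrow 1}f(tu+(1-t)u_0)$ for all $u\in\overline{D}^{s}$, and $\widehat{f}_{u_0}$ is ru-usc in $\overline{D}^{s}\cap \mathrm{dom}\,\widehat{f}_{u_0}$ relative to $u_0$.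
   Context: $X$ is a real Hausdorff topological vector space. For $f:X\to[-\infty,\infty]$, $\mathrm{dom} f:=\{u\in X: f(u)<\infty\}$. Ru-usc: for $a>0$, $D\subset\mathrm{dom} f$, $u_0\in D$ and $t\in[0,1]$ put $\Delta^a_{f,D,u_0}(t):=\sup_{u\in D}\frac{f(tu+(1-t)u_0)-f(u)}{a+|f(u)|}\in\,]-\infty,\infty]$. The function $f$ is radially uniformly upper semicontinuous (ru-usc) in $D$ relative to $u_0$ if there exists $a>0$ such that $\limsup_{t\to1}\Delta^a_{f,D,u_0}(t)\le 0$. The same definition is used for $\widehat f_{u_0}$, which is $>-\infty$ on $\overline D^{s}$ in this setting. Strongly star-shaped: $D\subset X$ is strongly star-shaped relative to $u_0\in D$ if $t\overline{D}+(1-t)u_0\subset D$ for all $t\in[0,1[$, where $\overline D$ is the closure of $D$ in $X$. Sequential closure: $u\in\overline{D}^{s}$ iff there is a sequence $\{v_n\}_n\subset D$ with $v_n\to u$ in $X$. Sequential relaxation: $\overline{g}^{s}(u)=\inf\{\liminf_{n\to\infty}g(u_n): u_n\in X,\ u_n\to u\}$. $\chi_D$ is the function equal to $0$ on $D$ and $\infty$ on $X\setminus D$. Radial extension: for $u_0\in\mathrm{dom} f$, $\widehat f_{u_0}:X\to[-\infty,\infty]$ is $\widehat f_{u_0}(u):=\liminf_{t\uparrow1}f(tu+(1-t)u_0)$, i.e. the infimum of $\liminf_{n\to\infty}f(t_nu+(1-t_n)u_0)$ over sequences $t_n\in[0,1[$ with $t_n\to1$. Convention: $(-\infty)+\infty=\infty$,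 so that $\widehat f_{u_0}+\chi_{\overline D^{s}}=\infty$ outside $\overline D^{s}$. *)

(* Defs.v *)
From HB Require Import structures.
From mathcomp Require Import all_boot all_order all_algebra.
From mathcomp Require Import all_classical all_reals all_analysis.

Set Implicit Arguments.
Unset Strict Implicit.
Unset Printing Implicit Defensive.

Import Order.TTheory GRing.Theory Num.Theory.
Import numFieldNormedType.Exports.

Local Open Scope classical_set_scope.
Local Open Scope ring_scope.

Section RadialRepresentation.
Context {R : realType} {X : topologicalLmodType R}.
(* [topologicalLmodType R] is a topological vector space without any local
   convexity requirement, unlike [tvsType R]. *)
Implicit Types (f g : X -> \bar R) (D : set X) (u : X).

Definition edom f : set X := [set u | (f u < +oo)%E].

Definition radial (u0 : X) (t : R) u : X := t *: u + (1 - t) *: u0.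

Definition ru_delta (a : R) f D (u0 : X) (t : R) : \bar R :=
  ereal_sup [set ((f (radial u0 t u) - f u) / (a%:E + `|f u|))%E | u in D].

(* The first two clauses say that [f] is finite on [D], so that the quotients
   in [ru_delta] are well defined (no -oo - -oo, no division by +oo).  The
   limit superior as t -> 1 in [0, 1] is taken along the left filter at 1:
   including t = 1 would change nothing, as [ru_delta a f D u0 1] = 0. *)
Definition ru_usc f D (u0 : X) : Prop :=
  [/\ D `<=` edom f,
      (forall u, D u -> (-oo < f u)%E),
      D u0 &
      exists2 a : R, 0 < a & (limf_esup (ru_delta a f D u0) 1^'- <= 0)%E].

Definition strongly_star_shaped D (u0 : X) : Prop :=
  D u0 /\
  forall (t : R) u, 0 <= t -> t < 1 -> closure D u -> D (radial u0 t u).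

Definition seq_closure D : set X :=
  [set u | exists v : nat -> X, (forall n, D (v n)) /\ v @ \oo --> u].

Definition seq_relaxation g u : \bar R :=
  ereal_inf [set limn_einf (g \o v) | v in [set v : nat -> X | v @ \oo --> u]].

Definition chi D u : \bar R := if u \in D then 0%E else +oo%E.

(* The dual addition of extended reals satisfies -oo + +oo = +oo, whereas the
   default one gives -oo. *)
Definition eplus f g u : \bar R := (f u + g u)%dE.

Definition radial_extension f (u0 : X) u : \bar R :=
  limf_einf (fun t : R => f (radial u0 t u)) 1^'-.

End RadialRepresentation.

(* Main.v *)
Require Import Defs.
From HB Require Import structures.
From mathcomp Require Import all_boot all_order all_algebra.
From mathcomp Require Import all_classical all_reals all_analysis.
From mathcomp Require Import ring lra.
Import Order.TTheory GRing.Theory Num.Theory.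
Import numFieldNormedType.Exports.
Local Open Scope classical_set_scope.
Local Open Scope ring_scope.

Set Implicit Arguments.
Unset Strict Implicit.

(** Write [u_t] for [radial u0 t u].  Two elementary facts drive everything.
    Radial contractions compose multiplicatively, [(u_t)_s = u_(st)]
    ([radialM]), so they commute.  And since [f] is bounded below on [D], the
    relative error [e * (a + |f w|)] allowed by radial uniform upper
    semicontinuity is small uniformly on the part of [D] where [f <= r]: for
    [t] close to 1, [f w <= r] implies [f w_t <= r + e]
    ([near_radial_sublevel]).

    Existence of the limit ([cvg_radial_extension]).  Let [u] be in the closure
    of [D], so that [u_t] is in [D] for [t < 1].  If the lower limit of
    [f u_t] is less than [r], there are [t] arbitrarily close to 1 with
    [f u_t < r].  Any [s] close to 1 lies below such a [t], with [s / t]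
    even closer to 1 than [s], and [u_s = (u_t)_(s/t)]; hence
    [f u_s <= r + e].  So the upper limit does not exceed the lower one.

    The radial extension is radially uniformly upper semicontinuous
    ([ru_usc_radial_extension]) with the same constant [a]: apply the
    inequality for [f] at the points [u_s] of [D], use [(u_s)_t = (u_t)_s], and
    let [s] tend to 1 on both sides.

    Relaxation.  At a point [u] of the sequential closure of [D], the sequence
    [u_(t_n)] with [t_n -> 1] lies in [D], converges to [u], and its values
    converge to the radial extension, which is thus at least the relaxation.
    Conversely, let [w_n -> u] in [D] with [f w_n <= r].  For [t] close to
    1, [f (w_n)_t <= r + e] for every [n], and [(w_n)_t -> u_t]; since [f]
    equals its relaxation at the point [u_t] of [D], [f u_t <= r + e].  Letting
    [t] tend to 1 bounds the radial extension by [r + e]. *)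

(** * Extended reals and lower limits along a filter *)

Section ExtendedReals.
Context {R : realType}.

(** Estimates of the form [y <= r + e] are derived for real [r] only, because a
    sublevel set at a real height has uniform error bounds; the infinite values
    of [x] are covered by the choice of [r]. *)
Lemma lee_of_real_above (x y : \bar R) :
  (forall r e : R, 0 < e -> (x < r%:E)%E -> (y <= (r + e)%:E)%E) -> (y <= x)%E.
Proof.
case: x => [x||] H; last 2 first.
- exact: leey.
- case: y H => [y||] H //.
    have := H (y - 2) 1 ltr01 (ltNyr _); rewrite lee_fin => {}H.
    exfalso; lra.
  by have := H 0 1 ltr01 (ltNyr _).
apply/lee_addgt0Pr => e e0.
have e20 : 0 < e / 2 by lra.
have xe : (x%:E < (x + e / 2)%:E)%E by rewrite lte_fin; lra.
by have := H _ _ e20 xe; rewrite -addrA -splitr EFinD.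
Qed.

Lemma lee_quotient (x : \bar R) (r d e : R) : 0 < d ->
  (((x - r%:E) / d%:E <= e%:E) = (x <= r%:E + e%:E * d%:E))%E.
Proof.
move=> d0; rewrite inver gt_eqF// lee_pdivrMr// leeBlDr//.
by rewrite addeC.
Qed.

End ExtendedReals.

Section FilterLimits.
Context {T : choiceType} {I : filteredType T} {R : realType}.
Context {F : set_system I} {FF : Filter F}.
Implicit Types (h : I -> \bar R) (c : \bar R).

Lemma near_lt_limf_einf h c :
  (c < limf_einf h F)%E -> \forall x \near F, (c < h x)%E.
Proof.
rewrite limf_einfE => /ereal_sup_gt[_ [V FV <-]] cV.
apply: filterS FV => x Vx; apply: (lt_le_trans cV).
by apply: ereal_inf_lbound; exists x.
Qed.

Lemma limf_einf_ge h c : (\forall x \near F, (c <= h x)%E) ->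
  (c <= limf_einf h F)%E.
Proof.
move=> ch; rewrite limf_einfE; apply: le_ereal_sup_tmp.
exists (ereal_inf (h @` [set x | (c <= h x)%E])).
  by exists [set x | (c <= h x)%E].
by apply: le_ereal_inf_tmp => _ [x cx <-].
Qed.

Lemma limf_einf_lt_frequently h c V :
  (limf_einf h F < c)%E -> F V -> exists2 x, V x & (h x < c)%E.
Proof.
move=> hc FV.
have : (ereal_inf (h @` V) < c)%E.
  apply: le_lt_trans hc; rewrite limf_einfE.
  by apply: ereal_sup_ubound; exists V.
by move=> /ereal_inf_lt[_ [x Vx <-] hxc]; exists x.
Qed.

Lemma limf_esup_leP h (c : R) :
  (limf_esup h F <= c%:E)%E <->
  forall e : R, 0 < e -> \forall x \near F, (h x <= (c + e)%:E)%E.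
Proof.
split=> [hc e e0|H].
  have : (limf_esup h F < (c + e)%:E)%E.
    by apply: le_lt_trans hc _; rewrite lte_fin ltrDl.
  rewrite limf_esupE => /ereal_inf_lt[_ [V FV <-]] Vc.
  apply: filterS FV => x Vx; apply/ltW/(le_lt_trans _ Vc).
  by apply: ereal_sup_ubound; exists x.
apply/lee_addgt0Pr => e /H He; rewrite limf_esupE; apply: ge_ereal_inf.
exists (ereal_sup (h @` [set x | (h x <= (c + e)%:E)%E])).
  by exists [set x | (h x <= (c + e)%:E)%E].
by apply: ge_ereal_sup => _ [x cx <-].
Qed.

End FilterLimits.

Section ProperFilterLimits.
Context {T : choiceType} {I : filteredType T} {R : realType}.
Context {F : set_system I} {FF : ProperFilter F}.
Implicit Types (h : I -> \bar R) (c : \bar R).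

Lemma limf_einf_le h c : (\forall x \near F, (h x <= c)%E) ->
  (limf_einf h F <= c)%E.
Proof.
move=> hc; rewrite leNgt; apply/negP => /near_lt_limf_einf ch.
have [x [hxc]] := @filter_ex _ F _ _ (@filterI _ F _ _ _ hc ch).
by rewrite ltNge hxc.
Qed.

(** The lower limit is a limit as soon as it also bounds [h] from above
    eventually, up to an arbitrary error; the bound from below is automatic. *)
Lemma cvg_limf_einf h :
  (forall r e : R, 0 < e -> (limf_einf h F < r%:E)%E ->
    \forall x \near F, (h x <= (r + e)%:E)%E) ->
  h @ F --> limf_einf h F.
Proof.
move=> H; have := @near_lt_limf_einf _ _ _ F _ h.
case: (limf_einf h F) H => [l||] H Hl.
- apply/fine_cvgP.
  have bnd e : 0 < e -> \forall x \near F,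
      ((l - e)%:E < h x)%E /\ (h x <= (l + e)%:E)%E.
    move=> e0; near=> x; split; near: x.
      by apply: Hl; rewrite lte_fin; lra.
    rewrite (_ : l + e = (l + e / 2) + e / 2); last lra.
    by apply: H; [lra | rewrite lte_fin; lra].
  split.
    near=> x; have : ((l - 1)%:E < h x)%E /\ (h x <= (l + 1)%:E)%E.
      by near: x; exact: bnd.
    by case: (h x) => [r||] [].
  apply/cvgrPdist_le => e e0; near=> x.
  have : ((l - e)%:E < h x)%E /\ (h x <= (l + e)%:E)%E by near: x; exact: bnd.
  rewrite /=; case: (h x) => [r||] [] //=; rewrite lte_fin lee_fin => lr rl.
  by rewrite ler_norml; apply/andP; split; lra.
- apply/cvgeyPge => A; near=> x; apply: ltW; near: x; exact: Hl (ltry _).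
- apply/cvgeNyPle => A; rewrite (_ : A = (A - 1) + 1); last lra.
  by apply: H; rewrite ?ltr01 ?ltNyr.
Unshelve. all: by end_near. Qed.

End ProperFilterLimits.

(** * Sequences *)

(** The indices chosen need not increase: it is enough that the [N]-th one is at
    least [N] for the extracted sequence to keep the limit. *)
Lemma frequently_subsequence {X : topologicalType} (P : set X)
    (v : nat -> X) (u : X) :
  v @ \oo --> u -> (forall N, exists2 n, (N <= n)%N & P (v n)) ->
  exists w : nat -> X, (forall n, P (w n)) /\ w @ \oo --> u.
Proof.
move=> vu H; have /choice[k Hk] : forall N, exists n, (N <= n)%N /\ P (v n).
  by move=> N; have [n ? ?] := H N; exists n.
exists (v \o k); split=> [n|]; first by case: (Hk n).
apply: cvg_comp vu => A [N _ NA]; exists N => // n /= Nn.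
by apply: NA => /=; apply: (leq_trans Nn); case: (Hk n).
Qed.

Lemma exists_seq_cvg_left1 (R : realType) :
  exists t : nat -> R, (forall n, 0 <= t n < 1) /\ t @ \oo --> (1 : R)^'-.
Proof.
pose t n : R := 1 - n.+1%:R^-1.
have t_lt1 n : t n < 1 by rewrite /t ltrBlDr ltrDl invr_gt0 ltr0n.
exists t; split=> [n|A].
  by rewrite t_lt1 andbT subr_ge0 invf_le1 ?ltr0n// ler1n.
have : t @ \oo --> (1 : R).
  rewrite -[X in _ --> X]subr0; apply: cvgB; first exact: cvg_cst.
  exact: cvg_harmonic.
by move=> t1 /t1; apply: (@filterS nat \oo) => n; apply; exact: t_lt1.
Qed.

(** * Radial contractions, sequential closure and relaxation *)

Section Radial.
Context {R : realType} {X : topologicalLmodType R}.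
Implicit Types (f : X -> \bar R) (D : set X) (u : X).

(** Contractions towards the same centre form a commutative monoid; this is what
    compares values of [f] at two points of one ray, and what exchanges two
    contractions in the double limit. *)
Lemma radialM (u0 u : X) (s t : R) :
  radial u0 s (radial u0 t u) = radial u0 (s * t) u.
Proof.
rewrite /radial scalerDr !scalerA -addrA -scalerDl.
by congr (_ + _ *: _); ring.
Qed.

Lemma radial_base (u0 : X) (t : R) : radial u0 t u0 = u0.
Proof. by rewrite /radial -scalerDl addrC subrK scale1r. Qed.

Lemma radial1 (u0 u : X) : radial u0 1 u = u.
Proof. by rewrite /radial subrr scale0r addr0 scale1r. Qed.

Lemma cvg_radial (I : Type) (F : set_system I) (FF : Filter F) (u0 u : X)
    (t : I -> R) (v : I -> X) (l : R) :
  t @ F --> l -> v @ F --> u ->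
  radial u0 (t x) (v x) @[x --> F] --> radial u0 l u.
Proof.
move=> tl vu.
have cvgZ (a : I -> R) (b : R) (w : I -> X) (z : X) :
    a @ F --> b -> w @ F --> z -> a x *: w x @[x --> F] --> b *: z.
  by apply: continuous2_cvg; exact: (@scale_continuous R X (b, z)).
apply: (@continuous2_cvg _ _ _ _ _ _ _ _ +%R).
- exact: (@add_continuous X (l *: u, (1 - l) *: u0)).
- exact: cvgZ.
- apply: cvgZ; last exact: cvg_cst.
  by apply: cvgB => //; exact: cvg_cst.
Qed.

(** Clearing the denominator replaces the quotients, and the supremum over [D],
    by an inequality that can be used pointwise and passed to the limit. *)
Lemma ru_delta_le0P f D u0 (a : R) : 0 < a ->
  (forall u, D u -> f u \is a fin_num) ->
  (limf_esup (ru_delta a f D u0) 1^'- <= 0)%E <->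
  forall e : R, 0 < e -> \forall t \near 1^'-, forall u, D u ->
    (f (radial u0 t u) <= f u + e%:E * (a%:E + `|f u|))%E.
Proof.
move=> a0 Dfin.
have E t e : (ru_delta a f D u0 t <= e%:E)%E <-> forall u, D u ->
    (f (radial u0 t u) <= f u + e%:E * (a%:E + `|f u|))%E.
  have Q u : D u ->
      ((f (radial u0 t u) - f u) / (a%:E + `|f u|) <= e%:E)%E =
      (f (radial u0 t u) <= f u + e%:E * (a%:E + `|f u|))%E.
    move=> /Dfin; case: (f u) => [r||]// _.
    by rewrite abse_EFin -EFinD lee_quotient// ltr_wpDr.
  split=> [H u Du|H].
    rewrite -Q//; apply: le_trans H.
    by apply: ereal_sup_ubound; exists u.
  by apply: ge_ereal_sup => _ [u Du <-]; rewrite Q//; exact: H.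
split.
  move=> /limf_esup_leP H e /H; apply: filterS => t.
  by rewrite add0r => /E.
move=> H; apply/limf_esup_leP => e /H; apply: filterS => t.
by rewrite add0r => /E.
Qed.

Lemma eplus_chi_in f D u : D u -> eplus f (chi D) u = f u.
Proof.
by move=> Du; rewrite /eplus /chi mem_set// DualAddTheoryNumDomain.dadde0.
Qed.

Lemma eplus_chi_out f D u : ~ D u -> eplus f (chi D) u = +oo%E.
Proof.
by move=> Du; rewrite /eplus /chi memNset// DualAddTheoryNumDomain.daddey.
Qed.

Lemma subset_seq_closure D : D `<=` seq_closure D.
Proof. by move=> u Du; exists (fun=> u); split=> //; exact: cvg_cst. Qed.

Lemma seq_closure_subset D : seq_closure D `<=` closure D.
Proof.
move=> u [v [Dv vu]] B /vu[N _ NB].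
by exists (v N); split=> //; apply: NB => /=.
Qed.

(** Only sequences in [D] along which [f] is bounded by a real number matter:
    if the lower limit of [eplus f (chi D)] along [v] is less than [r], then
    infinitely many terms lie in [D] with value below [r], and they form a
    sequence with the same limit.  When no such sequence exists the premise is
    vacuous, and [c = +oo] gives the infinite value outside of the sequential
    closure. *)
Lemma seq_relaxation_chi_ge f D u (c : \bar R) :
  (forall (r : R) (w : nat -> X), (forall n, D (w n)) -> w @ \oo --> u ->
    (forall n, (f (w n) <= r%:E)%E) ->
    forall e, 0 < e -> (c <= (r + e)%:E)%E) ->
  (c <= seq_relaxation (eplus f (chi D)) u)%E.
Proof.
move=> H; apply: le_ereal_inf_tmp => _ [v vu <-].
apply: lee_of_real_above => r e e0 vr.
have [w [Pw wu]] : exists w : nat -> X,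
    (forall n, D (w n) /\ (f (w n) <= r%:E)%E) /\ w @ \oo --> u.
  apply: (frequently_subsequence (P := fun x => D x /\ (f x <= r%:E)%E) vu).
  move=> N; have NN : \forall n \near \oo, (N <= n)%N by exact: nbhs_infty_ge.
  have [n /= Nn] := limf_einf_lt_frequently vr NN.
  have [Dv|nDv] := pselect (D (v n)).
    by rewrite eplus_chi_in// => /ltW fr; exists n.
  by rewrite eplus_chi_out.
by apply: (H r w _ wu _ e e0) => n; case: (Pw n).
Qed.

End Radial.

(** * Radial limits on a strongly star-shaped set *)

Section StarShaped.
Context {R : realType} {X : topologicalLmodType R}.
Variables (f : X -> \bar R) (D : set X) (u0 : X).
Hypothesis D_star : strongly_star_shaped D u0.
Hypothesis f_ru_usc : ru_usc f D u0.
Hypothesis f_inf : (-oo < ereal_inf (f @` D))%E.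

Lemma real_lower_bound : exists m : R, forall u, D u -> (m%:E <= f u)%E.
Proof.
have lb u : D u -> (ereal_inf (f @` D) <= f u)%E.
  by move=> Du; apply: ereal_inf_lbound; exists u.
case: (ereal_inf _) f_inf lb => [m||]// _ lb; first by exists m.
by exists 0 => u /lb; apply: le_trans; rewrite leey.
Qed.

Lemma ru_usc_fin u : D u -> f u \is a fin_num.
Proof.
case: f_ru_usc => Ddom DgtNy _ _ Du.
by rewrite fin_numElt DgtNy// Ddom.
Qed.

Lemma near_radial_in : \forall t \near (1 : R)^'-, forall u, closure D u ->
  D (radial u0 t u).
Proof.
near=> t; move=> u Du; apply: D_star.2 => //; near: t.
exact: nbhs_left_ge.
Unshelve. all: by end_near. Qed.

(** Where [m <= f u <= r], the weight [a + |f u|] is at most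
    [a + (|m| + |r|)], so the relative error becomes a uniform one. *)
Lemma near_radial_sublevel (r e : R) : 0 < e ->
  \forall t \near 1^'-, forall u, D u -> (f u <= r%:E)%E ->
    (f (radial u0 t u) <= (r + e)%:E)%E.
Proof.
move=> e0; have [m mD] := real_lower_bound.
case: (f_ru_usc) => _ _ _ [a a0 /(ru_delta_le0P _ a0 ru_usc_fin) H].
have C0 : 0 < a + (`|m| + `|r|).
  by rewrite ltr_wpDr// addr_ge0.
have eC0 : 0 < e / (a + (`|m| + `|r|)) by rewrite divr_gt0.
apply: filterS (H _ eC0) => t Ht u Du fur; apply: le_trans (Ht u Du) _.
have := mD u Du; have := ru_usc_fin Du; move: fur.
case: (f u) => [x||]//; rewrite !lee_fin => xr _ mx.
apply: lerD => //.
rewrite -[leRHS](divfK (lt0r_neq0 C0)) ler_pM2l// lerD2l.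
rewrite ler_norml; apply/andP; split.
  have := normr_ge0 r; have := lerNnormlW (lexx `|m|); lra.
have := normr_ge0 m; have := ler_norm r; lra.
Qed.

(** A value [f u_t < r] found at one [t] controls every [s] in a fixed left
    neighbourhood of 1 that lies below [t], since [u_s] is the contraction of
    [u_t] by [s / t], and [s < s / t < 1]. *)
Lemma cvg_radial_extension u : closure D u ->
  f (radial u0 t u) @[t --> 1^'-] --> radial_extension f u0 u.
Proof.
move=> Du; apply: cvg_limf_einf => r e e0 lr.
have := near_radial_sublevel r e0.
rewrite near_withinE => /nbhs_ballP[d /= d0 dP].
near=> s.
have s0 : 0 < s by near: s; apply: nbhs_left_gt.
have s1 : s < 1 by near: s; apply: nbhs_left_lt.
have sd : 1 - d < s by near: s; apply: nbhs_left_gt; lra.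
have [t /= [Dt st t1] tr] : exists2 t, [/\ D (radial u0 t u), s < t & t < 1] &
    (f (radial u0 t u) < r%:E)%E.
  apply: (limf_einf_lt_frequently lr); near=> t; split; near: t.
  - by apply: filterS near_radial_in => t; exact.
  - exact: nbhs_left_gt.
  - exact: nbhs_left_lt.
have t0 : 0 < t by lra.
rewrite -(divfK (lt0r_neq0 t0) s) -radialM; apply: dP => //.
- rewrite /ball /= ltr_norml.
  have : s / t < 1 by rewrite ltr_pdivrMr// mul1r.
  have : s < s / t by rewrite ltr_pdivlMr// gtr_pMr.
  by move=> *; apply/andP; split; lra.
- by rewrite ltr_pdivrMr// mul1r.
- exact: ltW.
Unshelve. all: by end_near. Qed.

Lemma radial_extension_gtNy u : closure D u ->
  (-oo < radial_extension f u0 u)%E.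
Proof.
move=> Du; have [m mD] := real_lower_bound.
apply: (lt_le_trans (ltNyr m)); apply: limf_einf_ge.
by apply: filterS near_radial_in => t /(_ u Du)/mD.
Qed.

(** Both sides of the inequality for [f] at [u_s] converge as [s] tends to 1; the
    left one because [f (u_s)_t = f (u_t)_s] and [u_t] is itself in [D]. *)
Lemma ru_usc_radial_extension :
  ru_usc (radial_extension f u0)
    (seq_closure D `&` edom (radial_extension f u0)) u0.
Proof.
have Dfin u : (seq_closure D `&` edom (radial_extension f u0)) u ->
    radial_extension f u0 u \is a fin_num.
  move=> [/seq_closure_subset/radial_extension_gtNy gtNy ltoo].
  by rewrite fin_numElt gtNy.
have D_u0 := D_star.1.
split=> [u []//|u [/seq_closure_subset/radial_extension_gtNy]//| |].
  split; first exact: subset_seq_closure.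
  have : (f u0 < +oo)%E by case: f_ru_usc => Ddom _ _ _; exact: Ddom.
  apply: le_lt_trans; apply: limf_einf_le.
  by near=> t; rewrite radial_base.
have [_ _ _ [a a0 /(ru_delta_le0P _ a0 ru_usc_fin) H]] := f_ru_usc.
exists a => //; apply/(ru_delta_le0P _ a0 Dfin) => e e0.
near=> t; move=> u Du.
have Dcu := seq_closure_subset Du.1.
have Dt : closure D (radial u0 t u).
  by apply: subset_closure; apply: (near near_radial_in t).
have lhs := cvg_radial_extension Dt.
have rhs := cvg_radial_extension Dcu.
have {}rhs : (f (radial u0 s u) + e%:E * (a%:E + `|f (radial u0 s u)|))%E
    @[s --> 1^'-] --> (radial_extension f u0 u +
      e%:E * (a%:E + `|radial_extension f u0 u|))%E.
  have fu := Dfin u Du.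
  apply: cvgeD => //; first by rewrite fin_num_adde_defr.
  apply: cvgeZl => //; apply: cvgeD => //; first exact: cvg_cst.
  exact: cvg_abse.
apply: (lee_cvg_to lhs rhs); near=> s.
rewrite radialM mulrC -radialM.
apply: (near (H e e0) t) => //.
by apply: (near near_radial_in s).
Unshelve. all: by end_near. Qed.

End StarShaped.

(** * Relaxation by radial extension *)

Theorem theorem3p2 (R : realType) (X : topologicalLmodType R)
    (f : X -> \bar R) (D : set X) (u0 : X)
    (X_hausdorff : hausdorff_space X)
    (f_gtNy : forall u, (-oo < f u)%E)
    (D_dom : D `<=` edom f)
    (D_u0 : D u0)
    (D_star : strongly_star_shaped D u0)
    (f_ru_usc : ru_usc f D u0)
    (f_inf : (-oo < ereal_inf (f @` D))%E) :
  ((forall u, D u -> seq_relaxation (eplus f (chi D)) u = f u) ->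
   forall u, seq_relaxation (eplus f (chi D)) u =
             eplus (radial_extension f u0) (chi (seq_closure D)) u)
  /\
  ((forall u, seq_closure D u ->
      f (t *: u + (1 - t) *: u0) @[t --> (1 : R)^'-] --> radial_extension f u0 u)
   /\
   ru_usc (radial_extension f u0)
     (seq_closure D `&` edom (radial_extension f u0)) u0).
Proof.
split; last first.
  split=> [u /seq_closure_subset Du|].
    exact: (cvg_radial_extension D_star f_ru_usc f_inf Du).
  exact: ru_usc_radial_extension.
move=> relax u; have [Du|nDu] := pselect (seq_closure D u); last first.
  rewrite (eplus_chi_out _ nDu); apply/eqP; rewrite eq_le leey andTb.
  apply: seq_relaxation_chi_ge => r w Dw wu.
  by case: nDu; exists w.
have Dcu := seq_closure_subset Du.
rewrite (eplus_chi_in _ Du); apply/eqP; rewrite eq_le; apply/andP; split.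
  (* A sequence along the ray to u, on which f tends to its radial limit. *)
  have [t [t01 t1]] := exists_seq_cvg_left1 R.
  have fv := cvg_comp _ _ t1 (cvg_radial_extension D_star f_ru_usc f_inf Dcu).
  rewrite -(cvg_limn_einf_sup fv).1.
  apply: ereal_inf_lbound; exists (fun n => radial u0 (t n) u).
    rewrite /= -[X in _ --> X](radial1 u0).
    apply: cvg_radial; last exact: cvg_cst.
    exact: cvg_trans t1 (@cvg_within _ _ _ _).
  congr limn_einf; apply/funext => n; rewrite /= eplus_chi_in//.
  by case/andP: (t01 n) => t0 tl1; exact: D_star.2.
apply: seq_relaxation_chi_ge => r w Dw wu wr e e0.
apply: limf_einf_le; near=> t.
have Dtu : D (radial u0 t u) by apply: (near (near_radial_in D_star) t).
(* Relaxation at the contracted point, tested on the contracted sequence. *)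
rewrite -relax//; apply: ge_ereal_inf.
exists (limn_einf (eplus f (chi D) \o (fun n => radial u0 t (w n)))).
  by exists (radial u0 t \o w) => //; apply: cvg_radial => //; exact: cvg_cst.
apply: limf_einf_le; near=> n.
have Dtw : D (radial u0 t (w n)).
  apply: (near (near_radial_in D_star) t) => //; exact: subset_closure.
rewrite /= eplus_chi_in//.
by apply: (near (near_radial_sublevel f_ru_usc f_inf r e0) t).
Unshelve. all: by end_near. Qed.
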